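(* Let $A\subset\mathbb{R}$ be a nonempty subset which is both an $F_\sigma$ and a $G_\delta$ subset of $\mathbb{R}$. Then there exists a linear operator $\varphi^\star\colon \mathscr{B}_1(A,\mathbb{R})\to\mathscr{B}_1(\mathbb{R},\mathbb{R})$ such that: (i) $\varphi^\star$ is an extension operator, i.e. $\varphi^\star(f)|_A=f$ for every $f\in\mathscr{B}_1(A,\mathbb{R})$; (ii) $\varphi^\star$ is non-negative, i.e. $f\geq 0$ on $A$ implies $\varphi^\star(f)\geq 0$ on $\mathbb{R}$; (iii) $\varphi^\star$ preserves unity, i.e. $\varphi^\star(1_A)=1_{\mathbb{R}}$, where $1_A$ and $1_{\mathbb{R}}$ are the constant functions equal to $1$ on $A$ and on $\mathbb{R}$; (iv) the restriction of $\varphi^\star$ to $\mathscr{B}_1^b(A,\mathbb{R})$ is an isometry with respect to supremum norms, i.e. $\|\varphi^\star(f)\|_{\mathbb{R}}=\|f\|_A$ for every $f\in\mathscr{B}_1^b(A,\mathbb{R})$.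
   Context: For topological spaces $Z,Y$, $\mathscr{B}_1(Z,Y)$ denotes the space of all pointwise limits of sequences of continuous functions $Z\to Y$ (Baire one functions). A subset $A\subset\mathbb{R}$ carries the subspace topology. $\mathscr{B}_1(Z,\mathbb{R})$ is a vector space under pointwise operations. $\mathscr{B}_1^b(Z,\mathbb{R})$ denotes the bounded elements of $\mathscr{B}_1(Z,\mathbb{R})$, with supremum norm $\|f\|_Z=\sup_{z\in Z}|f(z)|$. *)

(* Defs.v *)
From HB Require Import structures.
From mathcomp Require Import all_boot all_order all_algebra.
From mathcomp Require Import all_classical all_reals all_analysis borel_hierarchy.

Set Implicit Arguments.
Unset Strict Implicit.
Unset Printing Implicit Defensive.

Import Order.TTheory GRing.Theory Num.Theory.
Import numFieldNormedType.Exports.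

Local Open Scope classical_set_scope.
Local Open Scope ring_scope.

Definition baire_one (Z Y : topologicalType) : set (Z -> Y) :=
  [set f | exists g : nat -> Z -> Y,
    (forall n, continuous (g n)) /\ (forall z, g n z @[n --> \oo] --> f z)].

(* The values are taken in [R^o], i.e. [R] seen as a module over itself, so
   that [Z -> R^o] carries the pointwise vector space structure over [R]. *)
Definition baire_one_pred (R : realType) (Z : topologicalType)
  : {pred Z -> R^o} := mem (@baire_one Z R^o).

Lemma baire_one_cst (R : realType) (Z : topologicalType) (c : R) :
  cst c \in @baire_one_pred R Z.
Proof.
rewrite unfold_in inE; exists (fun=> cst c); split=> [_ z|z]; exact: cvg_cst.
Qed.

Lemma baire_one_submod_closed (R : realType) (Z : topologicalType) :
  submod_closed (@baire_one_pred R Z).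
Proof.
split; first exact: (@baire_one_cst R Z 0).
move=> a u v; rewrite !unfold_in !inE => -[g [gc gu]] [h [hc hv]].
exists (fun n => a *: g n + h n); split=> [n z|z].
  by apply: cvgD; [apply: cvgZl_tmp; exact: gc|exact: hc].
by apply: cvgD; [apply: cvgZl_tmp; exact: gu|exact: hv].
Qed.

HB.instance Definition _ (R : realType) (Z : topologicalType) :=
  GRing.isSubmodClosed.Build R (Z -> R^o) (@baire_one_pred R Z)
    (@baire_one_submod_closed R Z).

Record baireOne (R : realType) (Z : topologicalType) := BaireOne {
  baire_one_fun :> Z -> R^o ;
  _ : baire_one_fun \in @baire_one_pred R Z }.

HB.instance Definition _ (R : realType) (Z : topologicalType) :=
  [isSub for @baire_one_fun R Z].
HB.instance Definition _ (R : realType) (Z : topologicalType) :=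
  [Choice of @baireOne R Z by <:].
HB.instance Definition _ (R : realType) (Z : topologicalType) :=
  [SubChoice_isSubLmodule of @baireOne R Z by <:].

Definition baireOne_one (R : realType) (Z : topologicalType) : baireOne R Z :=
  BaireOne (@baire_one_cst R Z 1).

(* [sup] is only meaningful on nonempty bounded sets: [sup_norm f] is the
   supremum norm when [Z] is nonempty and [f] is bounded. *)
Definition sup_norm (R : realType) (Z : Type) (f : Z -> R) : R :=
  sup (range (fun z => `|f z|)).

(* The type of the elements of [A] with the topology induced by the ambient
   space. The library's [subspace A] is a different object: it keeps the points
   outside [A], as isolated points. *)
Notation subspaceType A := (initial_topology (@set_val _ A)).

(* Main.v *)
(* Collapsing the complement of A to a point a of A gives a retraction r of the
   line onto A, and f |-> f \o r is the extension operator. To see that f \o r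
   is Baire one when f is the limit of continuous h_n, write A and its
   complement as increasing unions of closed sets K_n and L_n (this is where
   both hypotheses on A are used). On the closed set K_n `|` L_n the map
   h_n \o r is continuous, being constant on L_n, so after truncation at height
   n + 1 Tietze's theorem extends it to a continuous function g_n, and g_n
   converges pointwise to f \o r. *)
From HB Require Import structures.
Require Import Defs.
From mathcomp Require Import all_boot all_order all_algebra.
From mathcomp Require Import all_classical all_reals all_analysis borel_hierarchy.

Import Order.TTheory GRing.Theory Num.Theory.
Import numFieldNormedType.Exports.

Local Open Scope classical_set_scope.
Local Open Scope ring_scope.

Definition truncate (R : realType) (M : R) (x : R^o) : R^o :=
  Num.max (- M) (Num.min M x).

Lemma continuous_truncate (R : realType) (M : R) : continuous (truncate R M).
Proof.
move=> x; apply: (@continuous_max _ _ (cst (- M)) (Num.min M)).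
  exact: cvg_cst.
by apply: (@continuous_min _ _ (cst M) idfun); [exact: cvg_cst|exact: cvg_id].
Qed.

Lemma normr_truncate (R : realType) (M x : R) :
  0 <= M -> `|truncate R M x| <= M.
Proof.
by move=> M0; rewrite ler_norml le_max lexx ge_max ge_min lexx/= andbT ge0_cp.
Qed.

Lemma truncate_id (R : realType) (M x : R) : `|x| <= M -> truncate R M x = x.
Proof.
by rewrite ler_norml => /andP[Mx xM]; rewrite /truncate (min_idPr xM) (max_idPr Mx).
Qed.

(** A convergent sequence is bounded, so once [n.+1] exceeds a bound the truncation leaves [u n]
    unchanged. *)
Lemma cvg_truncate (R : realType) (u : nat -> R^o) (l : R^o) :
  u n @[n --> \oo] --> l -> truncate R n.+1%:R (u n) @[n --> \oo] --> l.
Proof.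
move=> ul; have [M [_ uM]] := cvg_seq_bounded (cvgP _ ul).
apply: cvg_trans ul; apply: near_eq_cvg; near=> n.
rewrite truncate_id//; apply: (uM n.+1%:R) => //.
rewrite (@lt_trans _ _ n%:R) ?ltr_nat//.
by near: n; exact: nbhs_infty_gtr.
Unshelve. all: by end_near. Qed.

(** Finite partial unions of the closed pieces stay closed and, being increasing, eventually contain
    each point for good. *)
Lemma Fsigma_exhaustion {T : topologicalType} (S : set T) : Fsigma S ->
  exists F : (set T)^nat, [/\ forall n, closed (F n), forall n, F n `<=` S
    & forall x, S x -> \forall n \near \oo, F n x].
Proof.
move=> [F clF ->]; exists (fun n => \big[setU/set0]_(i < n) F i); split.
- by move=> n; apply: closed_bigsetU => i _; exact: clF.
- by move=> n x; rewrite -bigcup_mkord => -[i _ Fix]; exists i.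
- move=> x [i _ Fix]; exists i.+1 => // n /= ltin.
  by rewrite -bigcup_mkord; exists i.
Qed.

Lemma Gdelta_setC {T : topologicalType} (S : set T) : Gdelta S -> Fsigma (~` S).
Proof.
move=> [F opF ->]; exists (fun n => ~` F n); last by rewrite setC_bigcap.
by move=> n; exact: open_closedC.
Qed.

Section collapse.
Context {R : realType} {T : topologicalType} {A : set T}.
Context {r : T -> A} {a : A}.
Hypotheses (normalT : normal_space T) (FA : Fsigma A) (GA : Gdelta A).
Hypotheses (rA : forall x : A, r (set_val x) = x).
Hypotheses (rC : forall y, ~ A y -> r y = a).

Lemma within_continuous_collapse (h : subspaceType A -> R^o) (K L : set T) :
  closed K -> closed L -> K `<=` A -> L `<=` ~` A -> continuous h ->
  {within K `|` L, continuous (h \o r)}.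
Proof.
move=> clK clL KA LA ch; apply: withinU_continuous => //.
  (* Continuity within [A] amounts to continuity of the restriction to [A], and [h \o r] restricts
     to [h] because [r] fixes [A]. *)
  apply: (continuous_subspaceW KA); apply/subspace_sigL_continuousP.
  suff -> : sigL A (h \o r) = h by exact: ch.
  by apply/funext => x; rewrite /sigL/= rA.
apply: (@subspace_eq_continuous _ L _ (cst (h a) : T -> R^o)).
  by move=> y; rewrite inE => /LA /rC ry; exact/esym/(congr1 h ry).
by move=> y; exact: cvg_cst.
Qed.

Lemma baire_one_collapse (f : subspaceType A -> R^o) :
  baire_one f -> baire_one (f \o r : T -> R^o).
Proof.
move=> [h [ch hf]].
have [K [clK KA Kcover]] := Fsigma_exhaustion _ FA.
have [L [clL LA Lcover]] := Fsigma_exhaustion _ (Gdelta_setC _ GA).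
(* The height is [n.+1] because the bounded extension theorem needs a positive bound, also at
   [n = 0]. *)
pose k n : T -> R^o := truncate R n.+1%:R \o h n \o r.
have /choice[g gP] n : exists g : T -> R^o,
    continuous g /\ {in K n `|` L n, k n =1 g}.
  have ck : {within K n `|` L n, continuous (k n)}.
    apply: within_continuous_collapse => // x.
    by apply: continuous_comp; [exact: ch|exact: continuous_truncate].
  have [x _|g [kg cg _]] :=
    continuous_bounded_extension normalT (closedU (clK n) (clL n))
      (ltr0Sn R n) ck; first exact: normr_truncate.
  by exists g.
exists g; split=> [n|y]; first by have [] := gP n.
have : k n y @[n --> \oo] --> f (r y) by exact/cvg_truncate/hf.
(* It suffices that [g n y] and [k n y] agree for all large [n], that is, once [y] has entered [K n]
   or [L n]. *)
apply: cvg_trans; apply: near_eq_cvg.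
have : \forall n \near \oo, (K n `|` L n) y.
  have [/Kcover|/Lcover] := pselect (A y); apply: filterS => n ?; first by left.
  by right.
by apply: filterS => n KLy; have [_ ->] := gP n; rewrite ?inE.
Qed.

End collapse.

Lemma exists_collapse {T : Type} (A : set T) (a : A) :
  exists r : T -> A,
    (forall x : A, r (set_val x) = x) /\ (forall y, ~ A y -> r y = a).
Proof.
pose r y := if pselect (A y) is left Ay then SigSub (mem_set Ay) else a.
exists r; split=> [x|y]; rewrite /r; case: pselect => //.
  (* The membership proof found by [pselect] may differ from the one carried by [x]; only the
     underlying points matter. *)
  by move=> Ax; apply: val_inj.
by case; exact: set_valP.
Qed.

Theorem theorem3 (R : realType) (A : set R) :
  A !=set0 -> Fsigma A -> Gdelta A ->
  exists phi : {linear baireOne R (subspaceType A) -> baireOne R R},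
    [/\ forall (f : baireOne R (subspaceType A)) (x : A),
          phi f (set_val x) = f x,
        forall f : baireOne R (subspaceType A),
          (forall x : A, 0 <= f x) -> forall y : R, 0 <= phi f y,
        phi (baireOne_one R (subspaceType A)) = baireOne_one R R
      & forall f : baireOne R (subspaceType A),
          bounded_fun f ->
          bounded_fun (phi f) /\ sup_norm (phi f) = sup_norm f].
Proof.
move=> [a0 Aa0] FA GA; pose a : A := SigSub (mem_set Aa0).
have [r [rA rC]] := exists_collapse _ a.
have phiP (f : baireOne R (subspaceType A)) :
    ((f : _ -> _) \o r : R -> R^o) \in @baire_one_pred R R.
  rewrite unfold_in inE; apply: (baire_one_collapse _ FA GA rA rC).
    exact: pseudometric_normal.
  by have := valP f; rewrite unfold_in inE.
pose phi f : baireOne R R := BaireOne (phiP f).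
(* Precomposition with [r] commutes with pointwise operations by computation. *)
have linphi : linear phi by move=> c f g; apply/val_inj/funext.
pose philin := GRing.isLinear.Build _ _ _ _ phi linphi.
pose Phi : {linear baireOne R (subspaceType A) -> baireOne R R} :=
  HB.pack phi philin.
exists Phi; split.
- by move=> f x /=; rewrite rA.
- by move=> f f0 y; exact: f0.
- exact/val_inj/funext.
- move=> f [M [Mreal fM]]; split.
    by exists M; split=> // N MN y _; exact: fM.
  (* As [r] is onto [A], [f \o r] and [f] take the same values, so both suprema are of one set. *)
  rewrite /sup_norm; congr sup; apply/seteqP; split=> _ [y _ <-] /=.
    by exists (r y).
  by exists (set_val y) => //=; rewrite rA.
Qed.
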